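(* If $M\subseteq\mathbb{C}$ is a subset with non-empty interior (endowed with the topology induced by $\mathbb{C}$), then neither the free locally convex topological real vector space $L(M,\mathbb{R})$ over $M$ nor the free locally convex topological complex vector space $L(M,\mathbb{C})$ over $M$ is Mackey complete.
   Context: Let $\mathbb{K}\in\{\mathbb{R},\mathbb{C}\}$ and let $M$ be a completely regular topological space. The free locally convex topological $\mathbb{K}$-vector space over $M$ is a Hausdorff locally convex topological $\mathbb{K}$-vector space $L(M,\mathbb{K})$ together with a continuous map $\eta\colon M\to L(M,\mathbb{K})$ such that: (a) algebraically, $(L(M,\mathbb{K}),\eta)$ is the free $\mathbb{K}$-vector space over the set $M$ (i.e. $\eta$ is injective and $\eta(M)$ is a basis); (b) for each continuous map $\alpha\colon M\to E$ to a locally convex topological $\mathbb{K}$-vector space $E$, there exists a unique continuous $\mathbb{K}$-linear map $\overline{\alpha}\colon L(M,\mathbb{K})\to E$ with $\overline{\alpha}\circ\eta=\alpha$. Such a pair exists and is determined by these properties up to canonical isomorphism. A locally convex space $F$ is Mackey complete if it satisfies one of the following equivalent conditions: (M1) the Riemann integral $\int_0^1\gamma(t)\,dt$ exists in $F$ for each smooth curve $\gamma\colon\mathbb{R}\to F$; (M2) $\sum_{n=1}^\infty t_nx_n$ converges in $F$ for each bounded sequence $(x_n)_{n\in\mathbb{N}}$ in $F$ and each sequence $(t_n)_{n\in\mathbb{N}}$ of scalars such that $\sum_{n=1}^\infty|t_n|<\infty$. *)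

(* Defs.v *)
From HB Require Import structures.
From mathcomp Require Import all_boot all_order all_algebra.
From mathcomp Require Import all_classical all_reals all_analysis.
From mathcomp Require Import complex.

Set Implicit Arguments.
Unset Strict Implicit.
Unset Printing Implicit Defensive.

Import Order.TTheory GRing.Theory Num.Theory.

Local Open Scope classical_set_scope.
Local Open Scope ring_scope.

(* [tvsType K] is the library's type of locally convex topological K-vector
   spaces; Hausdorffness is not part of it. The uniformity it carries is not
   required to be translation invariant, so every notion below refers to the
   topology of the space only. *)

Definition set_basis (K : fieldType) (I : choiceType) (V : lmodType K)
    (b : I -> V) : Prop :=
  (forall (s : seq I) (c : I -> K), uniq s ->
     \sum_(i <- s) c i *: b i = 0 -> forall i, i \in s -> c i = 0) /\
  (forall v : V, exists (s : seq I) (c : I -> K),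
     v = \sum_(i <- s) c i *: b i).

(* The test spaces E of the universal property range over all locally convex
   spaces, Hausdorff or not. *)
Record free_locally_convex (K : numFieldType) (M : topologicalType)
    (L : tvsType K) (eta : M -> L) : Prop := FreeLocallyConvex {
  flc_hausdorff : hausdorff_space L ;
  flc_continuous : continuous eta ;
  flc_injective : injective eta ;
  flc_basis : set_basis eta ;
  flc_universal : forall (E : tvsType K) (alpha : M -> E), continuous alpha ->
    exists f : {linear L -> E},
      [/\ continuous f, f \o eta =1 alpha &
          forall g : {linear L -> E},
            continuous g -> g \o eta =1 alpha -> g =1 f]
}.

(* Boundedness in the sense of von Neumann; the library's [bounded_set] is
   about norms. *)
Definition tvs_bounded (K : numFieldType) (E : tvsType K) (B : set E) : Prop :=
  forall U : set E, nbhs 0 U ->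
    exists2 r : K, 0 < r &
      forall a : K, r <= `|a| -> B `<=` [set a *: u | u in U].

(* Of the equivalent definitions of Mackey completeness, this is the one by
   absolutely summable combinations of bounded sequences; the other one asks for
   the Riemann integrals of smooth curves. *)
Definition mackey_complete (K : numFieldType) (E : tvsType K) : Prop :=
  forall (x : nat -> E) (t : nat -> K),
    tvs_bounded (range x) ->
    cvgn (series (fun n => `|t n| : K^o)) ->
    exists l : E, series (fun n => t n *: x n) @ \oo --> l.

(* Main.v *)
(* For distinct points p_n converging to p_0 in M, the sequence (eta p_n)
   converges, hence is bounded, in L(M). If sum_n t_n eta(p_n), with summable
   t_n > 0, converged to a combination of the eta(q) for q in a finite set s,
   then every continuous alpha : M -> K vanishing on s would satisfy
   sum_n t_n alpha(p_n) = 0. This fails for the product alpha of the distances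
   to the points of s, which is nonnegative, and positive at every p_n outside
   s. *)

Require Import Defs.
From HB Require Import structures.
From mathcomp Require Import all_boot all_order all_algebra.
From mathcomp Require Import all_classical all_reals all_analysis.
From mathcomp Require Import complex.

Import Order.TTheory GRing.Theory Num.Theory.

Local Open Scope classical_set_scope.
Local Open Scope ring_scope.
Local Open Scope complex_scope.

(** Scalar multiplication is continuous at [(0, l)], so small scalars send all terms close to [l],
    hence a whole tail, into [U]. Each of the finitely many remaining terms is handled by continuity
    at [(0, x i)]. *)
Lemma tvs_bounded_cvg_range (K : numFieldType) (E : tvsType K) (x : nat -> E)
    (l : E) :
  x @ \oo --> l -> tvs_bounded (range x).
Proof.
move=> xl U U0.
have scale0 (v : E) : \forall z \near ((0 : K^o), v), U (z.1 *: z.2).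
  have := @scale_continuous K E (0, v).
  by rewrite /continuous_at /= scale0r => /(_ _ U0).
have [[A W] /= [A0 Wl] AWU] := scale0 l.
have [N _ Nx] := xl _ Wl.
have [e /= e0 eU] : \forall b \near (0 : K^o), forall n, U (b *: x n).
  have smallN : \forall b \near (0 : K^o), forall i : 'I_N, U (b *: x i).
    have := @filter_forall K^o 'I_N (fun i b => U (b *: x i)) (nbhs (0 : K^o)) _.
    apply => i.
    have [[B V] /= [B0 Vx] BVU] := scale0 (x i).
    apply: filterS B0 => b Bb; apply: (BVU (b, x i)); split=> //=.
    exact: nbhs_singleton.
  apply: filterS2 smallN A0 => b bN Ab n.
  have [nN|Nn] := ltnP n N; first exact: (bN (Ordinal nN)).
  by apply: (AWU (b, x n)); split=> //=; exact: Nx.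
(* The factor 2 gives [|a^-1| <= e / 2], strictly inside the open ball of radius [e] around 0. *)
exists (2 / e); first by rewrite divr_gt0.
move=> a ra _ [n _ <-].
have a0 : 0 < `|a| by apply: lt_le_trans ra; rewrite divr_gt0.
exists (a^-1 *: x n); last by rewrite scalerA divff ?scale1r// -normr_gt0.
apply: eU; rewrite /= sub0r normrN normfV invf_plt ?posrE//.
by apply: lt_le_trans ra; rewrite -[ltLHS]mul1r ltr_pM2r ?invr_gt0// ltr1n.
Qed.

(** Pigeonhole: [(size s).+1] distinct terms do not fit in [s]. *)
Lemma injective_seq_notin (T : eqType) (p : nat -> T) (s : seq T) :
  injective p -> exists n, p n \notin s.
Proof.
move=> p_inj; apply: contrapT => /forallNP ps.
have /uniq_leq_size : uniq (map p (iota 0 (size s).+1)).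
  by rewrite map_inj_uniq ?iota_uniq.
move=> /(_ s); rewrite size_map size_iota ltnn => /(_ _)/notF; apply.
by move=> _ /mapP[n _ ->]; apply: contrapT => /negP; exact: ps.
Qed.

(** The function [d] stands for the distance and takes its values in [K] itself, so that one
    argument covers real and complex scalars. *)
Lemma free_locally_convex_not_mackey (K : numFieldType) (M : topologicalType)
    (d : M -> M -> K) (p : nat -> M) (p0 : M) (t : nat -> K)
    (L : tvsType K) (eta : M -> L) :
  (forall q, continuous (d q : M -> K^o)) ->
  (forall q z, 0 <= d q z) -> (forall q z, (d q z == 0) = (q == z)) ->
  p @ \oo --> p0 -> injective p ->
  (forall n, 0 < t n) -> cvgn (series t : nat -> K^o) ->
  free_locally_convex eta -> ~ mackey_complete L.
Proof.
move=> d_cont d_ge0 d_eq0 pp0 p_inj t_gt0 t_cvg [_ eta_cont _ [_ eta_gen]].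
move=> eta_ext L_mackey.
have [||l sl] := L_mackey (eta \o p) t.
- apply: (@tvs_bounded_cvg_range _ _ _ (eta p0)).
  by apply: cvg_comp pp0 _; exact: eta_cont.
- by under eq_fun do rewrite gtr0_norm//.
have [s [c lE]] := eta_gen l.
pose alpha z : K^o := \prod_(q <- s) d q z.
have alpha_cont : continuous alpha.
  rewrite /alpha; elim: s {lE alpha} => [|q s IHs] z.
    by under eq_fun do rewrite big_nil; exact: cvg_cst.
  under eq_fun do rewrite big_cons.
  apply: cvgM; first exact: d_cont.
  exact: IHs.
have alpha_ge0 z : 0 <= alpha z by apply: prodr_ge0.
have alpha_eq0 z : (alpha z == 0) = (z \in s).
  rewrite prodf_seq_eq0 -has_pred1; apply: eq_has => q /=; exact: d_eq0.
have [f [f_cont f_eta _]] := eta_ext _ _ alpha_cont.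
have fl0 : f l = 0.
  rewrite lE linear_sum big_seq big1// => q qs.
  by rewrite linearZ/= [f _]f_eta (eqP (_ : alpha q == 0)) ?scaler0 ?alpha_eq0.
have [n pn] := injective_seq_notin _ _ s p_inj.
have a_gt0 : 0 < t n * alpha (p n).
  by rewrite mulr_gt0// lt0r alpha_ge0 alpha_eq0 pn.
have : (f \o series (fun m => t m *: (eta \o p) m)) @ \oo --> (0 : K^o).
  by rewrite -fl0; apply: cvg_comp sl _; exact: f_cont.
(* The tolerance is the [n]-th term itself. The index [maxn N n.+1] is at least [N], and the partial
   sum up to it contains that term; the other terms being nonnegative, the sum cannot be smaller. *)
move=> /cvgr0Pnorm_lt /(_ _ a_gt0) [N _ /(_ (maxn N n.+1))].
rewrite /= leq_maxl => /(_ isT).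
(* Negating [<] needs comparable sides, as [K] may be only partially ordered; both sides are
   nonnegative, hence real. *)
apply/negP; rewrite -real_leNgt ?ger0_real ?(ltW a_gt0)//.
have -> : f (series (fun m => t m *: (eta \o p) m) (maxn N n.+1)) =
    \sum_(0 <= m < maxn N n.+1) t m * alpha (p m).
  rewrite /series/= linear_sum; apply: eq_bigr => m _.
  by rewrite linearZ/= [f _]f_eta.
rewrite (bigD1_seq n) ?mem_index_iota ?iota_uniq ?leq_maxr//=.
have rest_ge0 : 0 <= \sum_(0 <= m < maxn N n.+1 | m != n) t m * alpha (p m).
  by apply: sumr_ge0 => m _; rewrite mulr_ge0// ltW.
by rewrite ger0_norm ?addr_ge0 ?ler_wpDr// ltW.
Qed.

Lemma cvg_set_type (T : Type) (X : topologicalType) (A : set X)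
    (F : set_system T) (p : T -> set_type A) (x : set_type A) :
  Filter F -> (set_val \o p) @ F --> set_val x -> p @ F --> x.
Proof.
move=> FF px B; rewrite nbhsE => -[V [[W oW <-] Wx] WB].
have /px : nbhs (set_val x) W by apply: open_nbhs_nbhs; split.
by apply: (@filterS _ F) => i Wi; exact: WB.
Qed.

Lemma normc_real (R : rcfType) (x : R) : `|x%:C| = `|x|%:C.
Proof. by rewrite normc_def /= expr0n addr0 sqrtr_sqr. Qed.

(** Numbers of [R[i]] are comparable only when their imaginary parts agree. Radii of balls in
    [R[i]], which are themselves elements of [R[i]], thus reduce to positive reals. *)
Lemma gtc0_Re (R : rcfType) (e : R[i]) :
  0 < e -> 0 < complex.Re e /\ e = (complex.Re e)%:C.
Proof. by case: e => a b; rewrite ltcE /= => /andP[/eqP -> ->]. Qed.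

Lemma continuous_real_complex (R : realType) :
  continuous (fun x : R^o => x%:C : R[i]^o).
Proof.
move=> x; apply/cvgrPdist_lt => e /gtc0_Re[e0 ->].
apply/nbhs_ballP; exists (complex.Re e) => //= y.
by rewrite /ball /= -rmorphB normc_real ltcR.
Qed.

Lemma continuous_Re (R : realType) :
  continuous (fun z : R[i]^o => complex.Re z : R^o).
Proof.
move=> z; apply/(@cvgrPdist_lt _ R^o _ (nbhs z)) => e e0.
apply/nbhs_ballP; exists e%:C => [|w]; first by rewrite /= ltcR.
rewrite /ball /= -ltcR; apply: le_lt_trans.
by rewrite -raddfB; exact: normc_ge_Re.
Qed.

Lemma continuous_dist (K : numFieldType) (x : K^o) :
  continuous (fun z : K^o => `|x - z| : K^o).
Proof.
move=> z; apply/(@cvgrPdist_lt _ K^o _ (nbhs z)) => e e0.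
apply/nbhs_ballP; exists e => //= w; rewrite /ball /=; apply: le_lt_trans.
apply: le_trans (ler_dist_dist _ _) _.
by rewrite opprB addrC addrA subrK distrC.
Qed.

Theorem proposition5p2 (R : realType) (M : set (R[i])^o) :
  interior M !=set0 ->
  (forall (L : tvsType R) (eta : set_type M -> L),
     free_locally_convex eta -> ~ mackey_complete L) /\
  (forall (L : tvsType R[i]) (eta : set_type M -> L),
     free_locally_convex eta -> ~ mackey_complete L).
Proof.
move=> [z0 /= /nbhs_ballP [e /= /gtc0_Re[] + -> Mball]].
set r := complex.Re e => r_gt0.
have half_lt1 : `|2^-1 : R| < 1 by rewrite ger0_norm ?invr_ge0// invf_lt1 ?ltr1n.
(* Starting at [r / 2] keeps every [z0 + u n] inside the open ball of radius [r] contained in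
   [M]. *)
pose u : R^nat := geometric (r / 2) 2^-1.
have u_lt n : `|u n| < r.
  rewrite ger0_norm /u /=; last first.
    by rewrite mulr_ge0 ?divr_ge0 ?exprn_ge0 ?invr_ge0// ltW.
  rewrite -mulrA gtr_pMr// -exprS exprn_ilt1 ?invr_ge0//.
  by rewrite invf_lt1 ?ltr1n.
have uM n : M (z0 + (u n)%:C).
  apply: Mball.
  by rewrite -ball_normE /= opprD addrA subrr sub0r normrN normc_real ltcR.
pose p n : set_type M := SigSub (mem_set (uM n)).
have rC_gt0 : 0 < r%:C by rewrite ltcR.
pose p0 : set_type M := SigSub (mem_set (Mball _ (ballxx z0 rC_gt0))).
have p_inj : injective p.
  (* Cancelling [z0] and the factor [r / 2] leaves equal powers of 1/2, whose exponents agree. *)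
  move=> m n /(congr1 val) /= /addrI/complexI/mulfI.
  rewrite mulf_neq0 ?gt_eqF ?invr_gt0// => /(_ isT).
  by apply: ieexprIn; rewrite ?invr_gt0// lt_eqF// invf_lt1 ?ltr1n.
have pp0 : p @ \oo --> p0.
  apply: cvg_set_type.
  have -> : set_val p0 = z0 + (0 : R)%:C by rewrite addr0 set_valE.
  rewrite set_valE; apply: cvgD; first exact: cvg_cst.
  apply: (@cvg_comp _ _ _ u (fun x : R^o => x%:C : R[i]^o) _ (nbhs (0 : R^o))).
    exact: cvg_geometric.
  exact: continuous_real_complex.
pose dist (q z : set_type M) : R[i] := `|val q - val z|.
have dist_cont q : continuous (dist q : _ -> R[i]^o).
  move=> z; apply: (@cvg_comp _ _ _ set_val (fun w => `|val q - w| : R[i]^o)).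
    exact: initial_continuous.
  exact: continuous_dist.
have dist_ge0 q z : 0 <= dist q z by exact: normr_ge0.
have dist_eq0 q z : (dist q z == 0) = (q == z).
  by rewrite normr_eq0 subr_eq0.
pose t : R^nat := geometric 1 2^-1.
have t_gt0 n : 0 < t n by rewrite /t /= mul1r exprn_gt0 ?invr_gt0.
have t_cvg : cvgn (series t : nat -> R^o) by exact: is_cvg_geometric_series.
split=> L eta flc.
(* The values of [dist] lie in [R[i]] but are nonnegative, hence real, so the real part is the same
   distance with values in [R]. *)
- apply: (@free_locally_convex_not_mackey R _ (fun q z => complex.Re (dist q z))
    p p0 t L eta) => //.
  + move=> q z; apply: (@cvg_comp _ _ _ (dist q)); first exact: dist_cont.
    exact: continuous_Re.
  + by move=> q z; have := dist_ge0 q z; rewrite lecE => /andP[].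
  + move=> q z; rewrite -dist_eq0; apply/eqP/eqP => [Re0|->//].
    by rewrite -(RRe_real (ger0_real (dist_ge0 q z))) Re0.
- apply: (@free_locally_convex_not_mackey R[i] _ dist p p0 (fun n => (t n)%:C) L
    eta) => //.
  + by move=> n; rewrite ltcR.
  + have /cvg_ex[l tl] := t_cvg; apply/cvg_ex; exists l%:C.
    (* The complex partial sums are the images of the real ones under the continuous embedding of
       [R]. *)
    have -> : series (fun n => (t n)%:C) = (fun x : R^o => x%:C) \o series t.
      by apply/funext => n; rewrite /series /= rmorph_sum.
    apply: cvg_comp tl _; exact: continuous_real_complex.
Qed.
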